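(* Let $K:\mathbb{R}^2\setminus\{0\}\to[0,+\infty)$ be rotationally invariant, $K(x)=K_0(|x|)$ with $K_0:(0,+\infty)\to[0,+\infty)$, and suppose that $\min\{1,|x|\}\,K(x)\in L^1(\mathbb{R}^2)$. Let $r>0$ and $$\mathcal{C}:=\{x=(x_1,x_2)\in\mathbb{R}^2: |x_1|\ge|x_2|\},\qquad \mathcal{C}_r:=[-r,r]^2\cup\mathcal{C}.$$ Then $$H^K_{\mathcal{C}_r}(p)\le0\qquad\text{for any }p\in\partial\mathcal{C}_r.$$ Also, for any $t\in[-r,r]$, $$H^K_{\mathcal{C}_r}(t,r)\le-2\Psi(r),\qquad\text{where}\quad \Psi(r):=\int_{B_{r/4}(7r/4,0)}K(x)\,dx .$$
   Context: For $E\subset\mathbb{R}^2$ and $x\in\partial E$, the $K$-curvature is $$H^K_E(x):=\lim_{\varepsilon\searrow0}\int_{\mathbb{R}^2\setminus B_\varepsilon(x)}\big(\chi_{\mathbb{R}^2\setminus E}(y)-\chi_E(y)\big)K(x-y)\,dy ,$$ which may take infinite values at points where $\partial E$ is not $C^{1,1}$ (so that the inequalities are understood in $[-\infty,+\infty]$). $B_\rho(a,b)$ denotes the ball of radius $\rho$ centered at $(a,b)$. *)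

(* Defs.v *)
From HB Require Import structures.
From mathcomp Require Import all_boot all_order all_algebra.
From mathcomp Require Import all_classical all_reals all_analysis.
Import Order.TTheory GRing.Theory Num.Theory.
Import numFieldNormedType.Exports.

Set Implicit Arguments.
Unset Strict Implicit.
Unset Printing Implicit Defensive.

Local Open Scope classical_set_scope.
Local Open Scope ring_scope.
Local Open Scope ereal_scope.

(* The library equips R * R with the sup norm, hence the explicit Euclidean
   norm and balls; the product topology on R * R is the Euclidean one. *)
Definition enorm (R : realType) (x : R * R) : R :=
  Num.sqrt (x.1 ^+ 2 + x.2 ^+ 2)%R.

Definition eball (R : realType) (x : R * R) (e : R) : set (R * R) :=
  [set y | (enorm (y - x)%R < e)%R].

Definition frontier (T : topologicalType) (E : set T) : set T :=
  closure E `\` E°.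

(* Lebesgue measure on the plane.  The completion makes integrability with
   respect to leb2 allow Lebesgue measurable, not only Borel, functions. *)
Definition leb2 (R : realType) :=
  @completed_measure_extension _ _ _
    (@lebesgue_measure R \x @lebesgue_measure R).

Definition truncated_curvature (R : realType) (K : R * R -> R)
    (E : set (R * R)) (x : R * R) (e : R) : \bar R :=
  \int[@leb2 R]_(y in ~` eball x e)
    ((\1_(~` E) y - \1_E y) * K (x - y))%R%:E.

(* The limit is taken in \bar R, so it may be infinite; it is meaningful only
   together with convergence of the truncated integrals. *)
Definition curvature (R : realType) (K : R * R -> R)
    (E : set (R * R)) (x : R * R) : \bar R :=
  lim (truncated_curvature K E x e @[e --> 0^'+]).

Definition cone (R : realType) : set (R * R) :=
  [set x | (`|x.2| <= `|x.1|)%R].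

Definition cone_square (R : realType) (r : R) : set (R * R) :=
  (`[(- r)%R, r] `*` `[(- r)%R, r]) `|` @cone R.

Definition Psi (R : realType) (K : R * R -> R) (r : R) : \bar R :=
  \int[@leb2 R]_(x in eball ((7 * r / 4)%R, 0%R) (r / 4)%R) (K x)%:E.

(* Main.v *)
(* Since [K] is radial, the truncated curvature at [p] is unchanged when the
   integrand is precomposed with an isometry fixing [p].  Average it over the
   four isometries [id], [-id], [s], [- s], where [s] swaps the coordinates
   relative to [p]: among the images of any point at most two lie outside
   [cone_square r] when [p] is on its frontier, so the averaged integrand is
   nonpositive.  Hence the truncated curvature is nonpositive and monotone in
   the radius.  At [(t, r)] this remains true after removing from the set a ball
   of radius [r / 4] at distance [7 r / 4] from [(t, r)] lying in the lower
   triangle of the square, and this ball contributes [- 2 Psi]. *)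

Require Import Defs.
From HB Require Import structures.
From mathcomp Require Import all_boot all_order all_algebra.
From mathcomp Require Import all_classical all_reals all_analysis.
From mathcomp Require Import measurable_realfun ring lra.
Import Order.TTheory GRing.Theory Num.Theory.
Import numFieldNormedType.Exports.
Local Open Scope classical_set_scope.
Local Open Scope ring_scope.
Local Open Scope ereal_scope.

(** * Maps preserving the Lebesgue measure of the plane *)

(** The pushforward under translation gives half-open intervals their length, which characterizes
    Lebesgue measure. *)
Lemma lebesgue_measure_translation (R : realType) (a : R)
    (A : set (measurableTypeR R)) : measurable A ->
  @lebesgue_measure R ((fun x : R => x + a)%R @^-1` A) = lebesgue_measure A.
Proof.
move=> mA.
have mtr : measurable_fun [set: measurableTypeR R]
    (fun x : measurableTypeR R => (x + a)%R : measurableTypeR R).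
  by apply: (@measurable_funD _ (measurableTypeR R) R setT id (cst a)).
change (pushforward (@lebesgue_measure R)
  (fun x : measurableTypeR R => (x + a)%R : measurableTypeR R) A = lebesgue_measure A).
apply/esym/lebesgue_measure_unique => //= _ [[x y] _ <-].
rewrite /pushforward /=.
have -> : (fun z => z + a)%R @^-1` `]x, y] = `](x - a)%R, (y - a)%R]%classic.
  by apply/seteqP; split => z /=; rewrite !in_itv /= ltrBlDr lerBrDr.
rewrite !lebesgue_measure_itv /= !lte_fin ltrD2r.
by rewrite -!EFinB opprB addrA subrK.
Qed.

Section plane_measure_isomorphisms.
Variable R : realType.
Let RR : measurableType _ := (measurableTypeR R * measurableTypeR R)%type.
Let m2 : {measure set RR -> \bar R} :=
  [the measure _ _ of (@lebesgue_measure R \x @lebesgue_measure R)].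

(** Only Borel sets and the product measure are involved here; the completion is reached later
    through outer measure. *)
Definition preserves_plane_measure (phi : R * R -> R * R) :=
  measurable_fun [set: RR] (phi : RR -> RR) /\
  forall A : set RR, measurable A -> m2 (phi @^-1` A) = m2 A.

Lemma preserves_plane_measure_comp (phi psi : R * R -> R * R) :
  preserves_plane_measure phi -> preserves_plane_measure psi ->
  preserves_plane_measure (psi \o phi).
Proof.
move=> [mphi phiE] [mpsi psiE]; split.
  by apply: (@measurableT_comp _ _ _ RR RR RR psi _ phi).
move=> A mA; rewrite comp_preimage phiE ?psiE//.
by rewrite -[X in measurable X]setTI; exact: mpsi.
Qed.

(** Integrate over vertical sections: a shear translates the section at [x] by [h x]. *)
Lemma preserves_plane_measure_shear (h : R -> R) :
  measurable_fun [set: measurableTypeR R] (h : measurableTypeR R -> measurableTypeR R) ->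
  preserves_plane_measure (fun z => (z.1, z.2 + h z.1)%R).
Proof.
move=> mh; split.
  apply: (@measurable_fun_pair _ _ _ RR (measurableTypeR R) (measurableTypeR R)).
    exact: measurable_fst.
  apply: (@measurable_funD _ RR R setT snd (h \o fst)).
    exact: measurable_snd.
  apply: (@measurableT_comp _ _ _ RR (measurableTypeR R) (measurableTypeR R) h _ fst) => //.
move=> A mA; rewrite /m2 /= /product_measure1.
apply: eq_integral => x _ /=.
rewrite -(@lebesgue_measure_translation R (h x) (xsection A x)); last first.
  exact: (@measurable_xsection _ _ (measurableTypeR R) (measurableTypeR R)).
by [].
Qed.

(** The pushforward agrees with the product measure on rectangles, hence everywhere. *)
Lemma preserves_plane_measure_swap : preserves_plane_measure (fun z => (z.2, z.1)).
Proof.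
have mswap : measurable_fun [set: RR] (fun z : RR => (z.2, z.1) : RR).
  apply: (@measurable_fun_pair _ _ _ RR (measurableTypeR R) (measurableTypeR R)).
    exact: measurable_snd.
  exact: measurable_fst.
split=> // A mA.
rewrite {2}/m2 /=.
change (pushforward m2 (fun z : RR => (z.2, z.1) : RR) A =
  (lebesgue_measure \x lebesgue_measure) A).
apply/esym/product_measure_unique => //= A1 A2 mA1 mA2.
rewrite /pushforward (_ : _ @^-1` _ = A2 `*` A1); last first.
  by apply/seteqP; split => -[x y] /= [].
by rewrite /m2 /= product_measure1E// muleC.
Qed.

(** The measure-preserving inverse serves to carry outer measure and Caratheodory measurability in
    both directions. *)
Definition plane_automorphism (phi : R * R -> R * R) :=
  exists psi, [/\ preserves_plane_measure phi, preserves_plane_measure psi,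
    cancel phi psi & cancel psi phi].

Lemma plane_automorphism_comp (phi psi : R * R -> R * R) :
  plane_automorphism phi -> plane_automorphism psi ->
  plane_automorphism (psi \o phi).
Proof.
move=> [phi' [p1 p2 p3 p4]] [psi' [q1 q2 q3 q4]]; exists (phi' \o psi').
by split; [exact: preserves_plane_measure_comp|exact: preserves_plane_measure_comp|
  exact: can_comp|exact: can_comp].
Qed.

Lemma plane_automorphism_swap : plane_automorphism (fun z => (z.2, z.1)).
Proof.
exists (fun z => (z.2, z.1)).
by split; [exact: preserves_plane_measure_swap|exact: preserves_plane_measure_swap|
  case|case].
Qed.

Lemma plane_automorphism_shear (h : R -> R) :
  measurable_fun [set: measurableTypeR R] (h : measurableTypeR R -> measurableTypeR R) ->
  plane_automorphism (fun z => (z.1, z.2 + h z.1)%R).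
Proof.
move=> mh; exists (fun z => (z.1, z.2 + (- h z.1))%R); split.
- exact: preserves_plane_measure_shear.
- apply: (preserves_plane_measure_shear (fun x => - h x)%R).
  exact: (@measurable_funN _ (measurableTypeR R) R setT h).
- by case=> x y /=; rewrite addrK.
- by case=> x y /=; rewrite subrK.
Qed.

Lemma plane_automorphism_linear_shear (k : R) :
  plane_automorphism (fun z => (z.1, z.2 + k * z.1)%R).
Proof.
apply: (plane_automorphism_shear (fun x => k * x)%R).
exact: (@measurable_funM _ (measurableTypeR R) R setT (cst k) id).
Qed.

Lemma plane_automorphism_linear_shear' (k : R) :
  plane_automorphism (fun z => (z.1 + k * z.2, z.2)%R).
Proof.
exact: (plane_automorphism_comp _ _
  (plane_automorphism_comp _ _ plane_automorphism_swap
    (plane_automorphism_linear_shear k)) plane_automorphism_swap).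
Qed.

Lemma plane_automorphism_translation (a : R * R) :
  plane_automorphism (fun z => a + z)%R.
Proof.
have T (c : R) : plane_automorphism (fun z => (z.1, z.2 + c)%R).
  by apply: (plane_automorphism_shear (fun=> c)).
have -> : (fun z => a + z)%R = (fun z => (z.1, z.2 + a.2)%R) \o
    ((fun z => (z.2, z.1)) \o (fun z => (z.1, z.2 + a.1)%R) \o (fun z => (z.2, z.1))).
  by apply/funext => -[x y]; rewrite [RHS]/= (addrC x) (addrC y).
apply: plane_automorphism_comp => //.
apply: plane_automorphism_comp; first exact: plane_automorphism_swap.
by apply: plane_automorphism_comp => //; exact: plane_automorphism_swap.
Qed.

(* A rotation by an angle in ]0, pi[ is a product of three shears. *)
Lemma plane_automorphism_rotation (a b : R) : (b != 0)%R ->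
  (a ^+ 2 + b ^+ 2 = 1)%R ->
  plane_automorphism (fun z => (a * z.1 + b * z.2, a * z.2 - b * z.1)%R).
Proof.
(* With [a] the cosine and [b] the sine of an angle, [k] is the tangent of half that angle. *)
move=> b0 ab1; pose k := ((1 - a) / b)%R.
have -> : (fun z => (a * z.1 + b * z.2, a * z.2 - b * z.1)%R) =
    (fun z : R * R => (z.1 + k * z.2, z.2)%R) \o
    ((fun z => (z.1, z.2 + - b * z.1)%R) \o (fun z => (z.1 + k * z.2, z.2)%R)).
  apply/funext => -[x y] /=; rewrite /k.
  have bE : (b ^+ 2 = 1 - a ^+ 2)%R by rewrite -ab1 addrC addKr.
  by congr pair; field: bE.
by apply: plane_automorphism_comp; [apply: plane_automorphism_comp|];
  rewrite /=; [exact: plane_automorphism_linear_shear'|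
  exact: plane_automorphism_linear_shear|exact: plane_automorphism_linear_shear'].
Qed.

Lemma plane_automorphism_opp : plane_automorphism (fun z => - z)%R.
Proof.
(* The half turn has sine 0, so it is obtained as the square of a quarter turn. *)
have Q : plane_automorphism (fun z => (0 * z.1 + 1 * z.2, 0 * z.2 - 1 * z.1)%R).
  by apply: plane_automorphism_rotation; rewrite ?oner_neq0// expr0n expr1n add0r.
have := plane_automorphism_comp _ _ Q Q.
congr plane_automorphism; apply/funext => -[x y] /=.
by rewrite !mul0r !mul1r !add0r.
Qed.

End plane_measure_isomorphisms.

(** * Invariance of the completed measure and change of variables *)

Section leb2_invariance.
Variable R : realType.
Let RR : measurableType _ := (measurableTypeR R * measurableTypeR R)%type.
Let m2 : {measure set RR -> \bar R} :=
  [the measure _ _ of (@lebesgue_measure R \x @lebesgue_measure R)].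
Let L2 : measurableType _ := caratheodory_type (m2^*)%mu.
Let mu : {measure set L2 -> \bar R} := [the measure _ _ of @leb2 R].

Lemma measurable_leb2 (A : set RR) : measurable A -> measurable (A : set L2).
Proof. exact: caratheodory_measurable_mu_ext. Qed.

Lemma measurable_fun_leb2 d (T : measurableType d) (f : RR -> T) :
  measurable_fun setT f -> measurable_fun setT (f : L2 -> T).
Proof.
move=> mf _ Y mY; apply: measurable_leb2.
by apply: mf.
Qed.

(** On an arbitrary set [leb2] is the outer measure, and a countable Borel cover of [X] pulls back
    to a cover of its preimage with the same total measure. *)
Lemma leb2_preimage_le (phi : R * R -> R * R) (X : set (R * R)) :
  preserves_plane_measure R phi -> leb2 (phi @^-1` X) <= leb2 X.
Proof.
move=> [mphi phiE]; apply: le_ereal_inf_tmp => _ [F [mF XF] <-].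
apply: ereal_inf_lbound; exists (fun k => phi @^-1` F k).
  split=> [k|x /XF[k _ Fk]]; last by exists k.
  by rewrite -[X in measurable X]setTI; exact: mphi.
by apply: eq_eseriesr => k _; exact: phiE.
Qed.

Lemma leb2_preimage (phi : R * R -> R * R) (X : set (R * R)) :
  plane_automorphism R phi -> leb2 (phi @^-1` X) = leb2 X.
Proof.
move=> [psi [phiP psiP phiK psiK]]; apply/eqP; rewrite eq_le leb2_preimage_le//=.
have := leb2_preimage_le psi (phi @^-1` X) psiP.
by rewrite -comp_preimage (_ : phi \o psi = id)//; exact/funext.
Qed.

(** Borel measurability of [phi] does not suffice for the completed sigma-algebra. Caratheodory's
    criterion is checked instead: each test set is moved by the inverse, and outer measure is
    invariant. *)
Lemma measurable_fun_plane_automorphism (phi : R * R -> R * R) :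
  plane_automorphism R phi -> measurable_fun [set: L2] (phi : L2 -> L2).
Proof.
move=> autphi _ A mA; rewrite setTI.
have cA : caratheodory_measurable (@leb2 R) A by exact: mA.
suff cphiA : caratheodory_measurable (@leb2 R) (phi @^-1` A) by exact: cphiA.
move=> X.
have [psi [_ _ phiK psiK]] := autphi.
have XE (B : set (R * R)) : X `&` phi @^-1` B = phi @^-1` (psi @^-1` X `&` B).
  by apply/seteqP; split => x /=; rewrite phiK.
rewrite preimage_setC !XE !(leb2_preimage phi)// -cA -(leb2_preimage phi (psi @^-1` X))//.
by congr leb2; apply/seteqP; split => x /=; rewrite phiK.
Qed.

Lemma integrable_plane_automorphism (phi : R * R -> R * R) (D : set L2)
    (f : L2 -> \bar R) : plane_automorphism R phi -> measurable D ->
  measurable_fun setT f -> mu.-integrable D f ->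
  mu.-integrable (phi @^-1` D) (f \o phi).
Proof.
move=> autphi mD mf /integrableP[mfD intf].
have mphi := measurable_fun_plane_automorphism _ autphi.
apply/integrableP; split.
  apply: measurable_funTS.
  exact: (@measurableT_comp _ _ _ L2 L2 _ f _ phi).
apply: le_lt_trans intf; rewrite le_eqVlt; apply/orP; left; apply/eqP.
have mf' : measurable_fun D (fun x => `|f x|).
  by apply: measurable_funTS; exact: measurableT_comp.
have f0 : {in D, forall y, 0 <= `|f y|} by [].
have <- : \int[pushforward mu (phi : L2 -> L2)]_(y in D) `|f y| = \int[mu]_(x in D) `|f x|.
  apply: eq_measure_integral => A mA _; exact: leb2_preimage.
by rewrite (ge0_integral_pushforward mphi mu mD mf' f0).
Qed.

(** Change of variables with unit Jacobian: the pushforward of [mu] by [phi] is [mu]. *)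
Lemma integral_plane_automorphism (phi : R * R -> R * R) (D : set L2)
    (f : L2 -> \bar R) : plane_automorphism R phi -> measurable D ->
  measurable_fun setT f -> mu.-integrable D f ->
  \int[mu]_(x in phi @^-1` D) f (phi x) = \int[mu]_(x in D) f x.
Proof.
move=> autphi mD mf intf.
have mphi := measurable_fun_plane_automorphism _ autphi.
have <- : \int[pushforward mu (phi : L2 -> L2)]_(y in D) f y = \int[mu]_(x in D) f x.
  apply: eq_measure_integral => A mA _; exact: leb2_preimage.
have intf' := integrable_plane_automorphism _ _ _ autphi mD mf intf.
by rewrite (integral_pushforward mphi mf intf' mD).
Qed.

End leb2_invariance.

(** * Geometry of the set and of its frontier *)

Lemma enorm_ge0 (R : realType) (z : R * R) : (0 <= enorm z)%R.
Proof. exact: sqrtr_ge0. Qed.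

Lemma enorm_opp (R : realType) (z : R * R) : enorm (- z)%R = enorm z.
Proof. by rewrite /enorm /= !sqrrN. Qed.

Lemma enorm_swap (R : realType) (z : R * R) : enorm (z.2, z.1) = enorm z.
Proof. by rewrite /enorm /= addrC. Qed.

Lemma enorm_rotation (R : realType) (a b : R) (z : R * R) :
  (a ^+ 2 + b ^+ 2 = 1)%R ->
  enorm (a * z.1 + b * z.2, a * z.2 - b * z.1)%R = enorm z.
Proof.
move=> ab1; rewrite /enorm /=; congr Num.sqrt.
transitivity ((a ^+ 2 + b ^+ 2) * (z.1 ^+ 2 + z.2 ^+ 2))%R; first ring.
by rewrite ab1 mul1r.
Qed.

Lemma enorm_ltE (R : realType) (z : R * R) (e : R) : (0 < e)%R ->
  (enorm z < e)%R = (z.1 ^+ 2 + z.2 ^+ 2 < e ^+ 2)%R.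
Proof.
by move=> e0; rewrite /enorm -{1}(gtr0_norm e0) -sqrtr_sqr ltr_sqrt ?exprn_gt0.
Qed.

Lemma norm1_le_enorm (R : realType) (z : R * R) : (`|z.1| <= enorm z)%R.
Proof. by rewrite /enorm -sqrtr_sqr; apply: ler_wsqrtr; rewrite lerDl sqr_ge0. Qed.

Lemma measurable_enorm (R : realType) :
  measurable_fun [set: (measurableTypeR R * measurableTypeR R)%type] (@enorm R).
Proof.
rewrite /enorm.
apply: (@measurableT_comp _ _ _ _ R R (@Num.sqrt R) _
  (fun z : measurableTypeR R * measurableTypeR R => (z.1 ^+ 2 + z.2 ^+ 2)%R)).
  exact: (continuous_measurable_fun (@sqrt_continuous R)).
apply: (@measurable_funD _
  (measurableTypeR R * measurableTypeR R)%type R setT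
  (fun z => z.1 ^+ 2)%R (fun z => z.2 ^+ 2)%R).
  apply: measurable_funX; exact: measurable_fst.
apply: measurable_funX; exact: measurable_snd.
Qed.

Section cone_square_geometry.
Variables (R : realType) (r : R).
Hypothesis r_gt0 : (0 < r)%R.

(** If [|x.2| <= r], then either [|x.2| <= |x.1|] and the point is in the cone, or
    [|x.1| < |x.2| <= r] and it is in the square. *)
Lemma cone_squareE (x : R * R) :
  cone_square r x <-> (`|x.2| <= r)%R \/ (`|x.2| <= `|x.1|)%R.
Proof.
rewrite /cone_square /cone /=; split.
  by case=> [[_]|]; [rewrite in_itv /= -ler_norml; left|right].
move=> [x2r|]; last by right.
have [x21|x12] := leP (`|x.2|)%R (`|x.1|)%R; first by right.
by left; rewrite !in_itv /= -!ler_norml x2r (le_trans (ltW x12)).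
Qed.

(** The set is [0 <= phi] for a continuous [phi], so it is closed and contains the open set
    [0 < phi]; its frontier thus lies in [phi = 0]. *)
Lemma frontier_cone_square (p : R * R) : frontier (cone_square r) p ->
  ((`|p.1| <= r) /\ `|p.2| = r \/ `|p.2| = `|p.1|)%R.
Proof.
pose phi (x : R * R) : R := (Num.max r `|x.1| - `|x.2|)%R.
have cphi : continuous phi.
  move=> x; apply: cvgB.
    apply: (@continuous_max R _ (cst r) (fun x : R * R => `|x.1|%R)).
      exact: cvg_cst.
    apply: cvg_norm; exact: cvg_fst.
  apply: cvg_norm; exact: cvg_snd.
have E0 : cone_square r = [set x | (0 <= phi x)%R].
  by apply/seteqP; split => x /=; rewrite /phi subr_ge0 le_max;
    [move/cone_squareE/orP|move/orP/cone_squareE].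
have cE : closed (cone_square r).
  rewrite E0 (_ : [set x | _] = phi @^-1` [set y | 0 <= y]%R)//.
  by apply: preimage_closed; [move=> x _; exact: cphi|exact: closed_ge].
have oU : open [set x | (0 < phi x)%R].
  rewrite (_ : [set x | _] = phi @^-1` [set y | 0 < y]%R)//.
  by apply: open_comp; [move=> x _; exact: cphi|exact: open_gt].
move=> [clE nE].
have : (0 <= phi p)%R by have := clE; rewrite -((closure_id _).1 cE) E0.
rewrite le_eqVlt => /orP[/eqP phip0|phip0]; last first.
  exfalso; apply: nE; suff : [set x | (0 < phi x)%R] `<=` (cone_square r)°%classic by apply.
  rewrite -open_subsetE //.
  by move=> x /= /ltW; rewrite E0.
have : (`|p.2| = Num.max r `|p.1|)%R by apply/eqP; rewrite eq_sym -subr_eq0 phip0.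
by rewrite maxEle; case: leP => [rp ->|pr ->]; [right|left; split => //; exact: ltW].
Qed.

(* Contains the complements of [cone_square r] and of [cone_square r] minus the
   ball removed at [(t, r)]. *)
Definition above_or_below (x : R * R) :=
  (`|x.1| < `|x.2|)%R /\ ((r < x.2)%R \/ (x.2 < 0)%R).

(** For [z = (a, b)] the first two points force [b > r] or [b < - r]. Take [b > r]. At the third
    point, [a > 0] gives [t + b < r + a], against [a - t < b - r] from the second; [r + a < 0] gives
    [t + b < - r - a], against [- t - a < r + b] from the first. The case [b < - r] is similar. *)
Lemma top_edge_reflections (t : R) (z : R * R) : (- r <= t <= r)%R ->
  above_or_below ((t, r) + z)%R -> above_or_below ((t, r) - z)%R ->
  above_or_below ((t, r) + (z.2, z.1))%R -> False.
Proof.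
case: z => a b /andP[t1 t2]; rewrite /above_or_below /=.
move=> [A1 A2] [B1 B2] [C1 C2].
move: A1 B1 C1; rewrite !real_ltr_normr ?num_real// !real_ltr_norml ?num_real//.
case: A2 => A2; case: B2 => B2; case: C2 => C2;
move=> /orP[]/andP[? ?] /orP[]/andP[? ?] /orP[]/andP[? ?]; lra.
Qed.

(** The bottom edge reduces to the top edge by negating all points. On a diagonal, the third point
    is the swap of the first or the negated swap of the second, and the two cannot both satisfy
    [|x.1| < |x.2|]. *)
Lemma frontier_reflections (p z : R * R) :
  ((`|p.1| <= r) /\ `|p.2| = r \/ `|p.2| = `|p.1|)%R ->
  ~ cone_square r (p + z)%R -> ~ cone_square r (p - z)%R ->
  ~ cone_square r (p + (z.2, z.1))%R -> False.
Proof.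
case: p z => [s u] [a b]; rewrite !cone_squareE /= => H.
move=> /not_orP[/negP A1 /negP A2] /not_orP[/negP B1 /negP B2] /not_orP[/negP C1 /negP C2].
move: A1 A2 B1 B2 C1 C2; rewrite -!ltNge => A1 A2 B1 B2 C1 C2.
have N (x y : R) : (r < `|y|)%R -> (`|x| < `|y|)%R -> above_or_below (x, y).
  move=> ry xy; split => //=.
  by move: ry; rewrite ltr_normr => /orP[|ry];
    [left|right; rewrite -oppr_gt0; exact: lt_trans ry].
have N' (x y x' y' : R) : x = (- x')%R -> y = (- y')%R ->
    (r < `|y'|)%R -> (`|x'| < `|y'|)%R -> above_or_below (x, y).
  by move=> -> -> ? ?; apply: N; rewrite !normrN.
case: H => [[sr ur]|su].
  have sr' : (- r <= s <= r)%R by rewrite -ler_norml.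
  have [uE|uE] : u = r \/ u = (- r)%R.
    by move: ur; case: (ger0P u) => _ <-; [left|right; rewrite opprK].
  - by rewrite uE in A1 A2 B1 B2 C1 C2;
      apply: (@top_edge_reflections s (a, b)); last 3 first; [exact: N..|].
  - rewrite uE in A1 A2 B1 B2 C1 C2.
    apply: (@top_edge_reflections (- s)%R (- a, - b)%R); first by lra.
    + by apply: (N' _ _ _ _ _ _ A1 A2); rewrite /=; lra.
    + by apply: (N' _ _ _ _ _ _ B1 B2); rewrite /=; lra.
    + by apply: (N' _ _ _ _ _ _ C1 C2); rewrite /=; lra.
have [us|us] : u = s \/ u = (- s)%R.
  by move/eqP: su; rewrite eqr_norm2 => /orP[]/eqP; [left|right].
- by move: A2 C2; rewrite us => A2 C2; have := lt_trans A2 C2; rewrite ltxx.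
- move: B2 C2; rewrite us -!opprD !normrN (_ : - s + a = - (s - a))%R ?normrN; last lra.
  by move=> B2 C2; have := lt_trans B2 C2; rewrite ltxx.
Qed.

End cone_square_geometry.

(** * Truncated curvatures *)

Section symmetrization.
Variables (R : realType) (K0 : R -> R) (K : R * R -> R).
Hypothesis K0_ge0 : forall s : R, (0 < s)%R -> (0 <= K0 s)%R.
Hypothesis K_radial : forall x : R * R, x <> 0%R -> K x = K0 (enorm x).
Hypothesis K_int : (@leb2 R).-integrable setT
  (fun x : R * R => (Num.min 1 (enorm x) * K x)%R%:E).

Let RR : measurableType _ := (measurableTypeR R * measurableTypeR R)%type.
Let m2 : {measure set RR -> \bar R} :=
  [the measure _ _ of (@lebesgue_measure R \x @lebesgue_measure R)].
Let L2 : measurableType _ := caratheodory_type (m2^*)%mu.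
Let mu : {measure set L2 -> \bar R} := [the measure _ _ of @leb2 R].

(* [K] with its junk value at the origin replaced by 0, which makes it
   radial, nonnegative and measurable on the whole plane. *)
Definition punctured (z : R * R) : R :=
  ((Num.min 1 (enorm z))^-1 * (Num.min 1 (enorm z) * K z))%R.

Lemma puncturedE (z : R * R) : (0 < enorm z)%R -> punctured z = K z.
Proof. by move=> z0; rewrite /punctured mulKf// gt_eqF// lt_min ltr01. Qed.

Lemma puncturedP (z : R * R) : (z = 0%R /\ punctured z = 0%R) \/
  (0 < enorm z)%R /\ punctured z = K0 (enorm z).
Proof.
have [z0|/eqP z0] := eqVneq z 0%R.
  left; split => //; rewrite /punctured z0 /enorm /= expr0n addr0 sqrtr0.
  (* The inverse of 0 is 0 by convention. *)
  by rewrite (min_idPr ler01) invr0 mul0r.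
have ez : (0 < enorm z)%R.
  rewrite /enorm sqrtr_gt0 lt_neqAle addr_ge0 ?sqr_ge0// andbT eq_sym.
  apply/eqP => /eqP; rewrite paddr_eq0 ?sqr_ge0// !sqrf_eq0 => /andP[/eqP z1 /eqP z2].
  by apply: z0; case: z z1 z2 => x y /= -> ->.
by right; split => //; rewrite puncturedE// K_radial.
Qed.

Lemma punctured_ge0 z : (0 <= punctured z)%R.
Proof. by case: (puncturedP z) => -[z0 ->] //; exact: K0_ge0. Qed.

Lemma eq_punctured (z w : R * R) : enorm z = enorm w -> punctured z = punctured w.
Proof.
have e0 : enorm (0%R : R * R) = 0%R by rewrite /enorm /= expr0n addr0 sqrtr0.
case: (puncturedP z) => -[z0 ->]; case: (puncturedP w) => -[w0 ->] // zw.
- by move: w0; rewrite -zw z0 e0 ltxx.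
- by move: z0; rewrite zw w0 e0 ltxx.
- by rewrite zw.
Qed.

Lemma measurable_enorm_leb2 : measurable_fun [set: L2] (@enorm R).
Proof. exact: (measurable_fun_leb2 _ _ R _ (measurable_enorm R)). Qed.

(** Integrability of the weighted kernel makes it measurable; dividing by the measurable weight
    keeps this. *)
Lemma measurable_punctured : measurable_fun [set: L2] punctured.
Proof.
have mmin : measurable_fun [set: L2] (fun z => Num.min 1 (enorm z))%R.
  exact: (measurable_minr (measurable_cst (1%R : R)) measurable_enorm_leb2).
apply: (@measurable_funM _ L2 R setT
  (fun z => (Num.min 1 (enorm z))^-1)%R (fun z => Num.min 1 (enorm z) * K z)%R).
  (* On nonnegative reals, 0 included, the inverse is the power with exponent -1, whose
     measurability is known. *)
  have -> : (fun z : L2 => (Num.min 1 (enorm z))^-1)%R =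
      (fun x : R => x `^ (-1))%R \o (fun z => Num.min 1 (enorm z))%R.
    by apply/funext => z /=; rewrite powR_inv1// le_min ler01 enorm_ge0.
  apply: (@measurableT_comp _ _ _ L2 R R (fun x : R => x `^ (-1))%R _
    (fun z => Num.min 1 (enorm z))%R) => //.
by apply/measurable_EFinP; case/integrableP : K_int.
Qed.

Lemma plane_automorphism_reflection (p : R * R) :
  plane_automorphism R (fun y => p - y)%R.
Proof.
exact: (plane_automorphism_comp _ _ _ (plane_automorphism_opp R)
  (plane_automorphism_translation R p)).
Qed.

Lemma measurable_exterior (e : R) : measurable ([set z | (e <= enorm z)%R] : set L2).
Proof.
rewrite (_ : [set z | _] = setT `&` @enorm R @^-1` `[e, +oo[); last first.
  by apply/seteqP; split => z /=; rewrite in_itv /= andbT // => -[].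
exact: measurable_enorm_leb2.
Qed.

Lemma measurable_preimage (phi : R * R -> R * R) (A : set L2) :
  plane_automorphism R phi -> measurable A -> measurable (phi @^-1` A : set L2).
Proof.
move=> autphi mA; rewrite -[X in measurable X]setTI.
exact: (measurable_fun_plane_automorphism _ _ autphi).
Qed.

Lemma preimage_exterior (p : R * R) (e : R) :
  (fun y => p - y)%R @^-1` [set z | (e <= enorm z)%R] = ~` eball p e.
Proof.
by apply/seteqP; split => y; rewrite /eball /= -(enorm_opp _ (p - y)%R) opprB leNgt =>
  /negP.
Qed.

Lemma measurable_eball (c : R * R) (e : R) : measurable (eball c e : set L2).
Proof.
rewrite -[X in measurable X]setCK -preimage_exterior; apply: measurableC.
apply: measurable_preimage; first exact: plane_automorphism_reflection.
exact: measurable_exterior.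
Qed.

(** Outside the ball of radius [e] one has [min 1 e <= min 1 (enorm z)], so the integrable weighted
    kernel divided by [min 1 e] dominates. *)
Lemma integrable_punctured (e : R) (D : set L2) (s : L2 -> R) : (0 < e)%R ->
  measurable D -> D `<=` [set z | (e <= enorm z)%R] ->
  measurable_fun setT s -> (forall z, `|s z| <= 1)%R ->
  mu.-integrable D (fun z => (s z * punctured z)%:E).
Proof.
move=> e0 mD De ms s1.
have intD : mu.-integrable D
    (fun z => ((Num.min 1 e)^-1)%:E * (Num.min 1 (enorm z) * K z)%:E).
  apply: integrableZl => //.
  by apply: (@integrableS _ _ _ mu setT D) => //; exact: subsetT.
apply: (le_integrable mD _ _ intD).
  apply/measurable_EFinP; apply: measurable_funTS.
  exact: (measurable_funM ms measurable_punctured).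
move=> z Dz; rewrite -EFinM !abse_EFin lee_fin.
have ez : (e <= enorm z)%R := De z Dz.
have z0 : (0 < enorm z)%R by exact: lt_le_trans ez.
have k0 := punctured_ge0 z.
rewrite [leLHS]normrM (ger0_norm k0) (le_trans (ler_wpM2r k0 (s1 z)))// mul1r.
have m0 : (0 < Num.min 1 e)%R by rewrite lt_min ltr01.
rewrite (puncturedE _ z0) in k0 *.
rewrite ger0_norm; last first.
  by rewrite mulr_ge0 ?invr_ge0 ?mulr_ge0 ?le_min ?ler01 ?(ltW m0) ?(ltW e0) ?(ltW z0).
rewrite mulrA ler_peMl// ler_pdivlMl// mulr1.
by rewrite le_min !ge_min lexx ez orbT.
Qed.

(** This is the factor of the curvature integrand: -1 on [A] and 1 off [A]. *)
Definition sign_weight (A : set L2) (x : R * R) : R := (1 - 2 * \1_A x)%R.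

Lemma measurable_sign_weight (A : set L2) (phi : R * R -> R * R) :
  plane_automorphism R phi -> measurable A ->
  measurable_fun [set: L2] (fun z => sign_weight A (phi z)).
Proof.
move=> autphi mA; rewrite /sign_weight.
have m1 : measurable_fun [set: L2] (fun z : L2 => \1_A (phi z) : R).
  have mphi := measurable_fun_plane_automorphism _ _ autphi.
  have mind : measurable_fun [set: L2] (\1_A : L2 -> R) by exact: measurable_indic.
  exact: (measurableT_comp mind mphi).
have m2' := measurable_funM (measurable_cst (2%R : R)) m1.
exact: (measurable_funB (measurable_cst (1%R : R)) m2').
Qed.

Lemma norm_sign_weight (A : set L2) x : (`|sign_weight A x| <= 1)%R.
Proof.
rewrite /sign_weight indicE; case: (_ \in _) => /=.
  by rewrite mulr1 (_ : 1 - 2 = - 1)%R ?normrN1//; ring.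
by rewrite mulr0 subr0 normr1.
Qed.

Lemma integrable_sign_weight (A : set L2) (phi : R * R -> R * R) (e : R) :
  plane_automorphism R phi -> measurable A -> (0 < e)%R ->
  mu.-integrable [set z | (e <= enorm z)%R]
    (fun z => (sign_weight A (phi z) * punctured z)%:E).
Proof.
move=> autphi mA e0.
exact: (integrable_punctured e _ (fun z => sign_weight A (phi z)) e0
  (measurable_exterior e) (@subset_refl _ _) (measurable_sign_weight _ _ autphi mA)
  (fun z => norm_sign_weight A (phi z))).
Qed.

Lemma measurable_sign_weight_punctured (A : set L2) (phi : R * R -> R * R) :
  plane_automorphism R phi -> measurable A ->
  measurable_fun [set: L2] (fun z => (sign_weight A (phi z) * punctured z)%:E).
Proof.
move=> autphi mA; apply/measurable_EFinP.
apply: (@measurable_funM _ L2 R setT _ punctured).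
  exact: measurable_sign_weight.
exact: measurable_punctured.
Qed.

(** Substitute [z = p - y], which centres the domain at the origin; there [K] and [punctured] agree
    because [e] is positive. *)
Lemma truncated_curvatureE (A : set L2) (p : R * R) (e : R) :
  measurable A -> (0 < e)%R ->
  truncated_curvature K A p e =
  \int[mu]_(z in [set z | (e <= enorm z)%R]) (sign_weight A (p - z) * punctured z)%:E.
Proof.
move=> mA e0; have autp := plane_automorphism_reflection p.
rewrite -(integral_plane_automorphism _ _ _
  (fun z => (sign_weight A (p - z) * punctured z)%:E) autp (measurable_exterior e)).
- rewrite preimage_exterior; apply: eq_integral => y; rewrite inE /= => ye.
  have py : (0 < enorm (p - y))%R.
    rewrite -enorm_opp opprB (lt_le_trans e0)// leNgt; exact/negP.
  rewrite subKr puncturedE// /sign_weight !indicE in_setC.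
  by case: (y \in A) => /=; congr ((_ * _)%:E); ring.
- exact: measurable_sign_weight_punctured.
- exact: integrable_sign_weight.
Qed.

Lemma truncated_curvature_isometry (A : set L2) (p : R * R) (e : R)
  (g : R * R -> R * R) : measurable A -> (0 < e)%R ->
  plane_automorphism R g -> (forall z, enorm (g z) = enorm z) ->
  truncated_curvature K A p e =
  \int[mu]_(z in [set z | (e <= enorm z)%R])
    (sign_weight A (p - g z) * punctured z)%:E.
Proof.
move=> mA e0 autg isog; rewrite truncated_curvatureE//.
have autp := plane_automorphism_reflection p.
rewrite -(integral_plane_automorphism _ _ _
  (fun z => (sign_weight A (p - z) * punctured z)%:E) autg (measurable_exterior e)).
- rewrite (_ : g @^-1` _ = [set z | e <= enorm z]%R); last first.
    by apply/seteqP; split => z /=; rewrite isog.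
  by apply: eq_integral => z _; rewrite (eq_punctured (g z) z).
- exact: measurable_sign_weight_punctured.
- exact: integrable_sign_weight.
Qed.

(** The sum over the four isometries rather than their average, whence the factor 4 below. *)
Definition symmetrized_weight (A : set L2) (p z : R * R) : R :=
  (sign_weight A (p - z) + sign_weight A (p - - z) +
   sign_weight A (p - (z.2, z.1)) + sign_weight A (p - - (z.2, z.1)))%R.

Lemma symmetrized_weight_le0 (A : set L2) (p : R * R) :
  (forall z : R * R, ~ A (p + z)%R -> ~ A (p - z)%R -> ~ A (p + (z.2, z.1))%R -> False) ->
  forall z, (symmetrized_weight A p z <= 0)%R.
Proof.
move=> HA z.
have swE (x : R * R) : A x /\ sign_weight A x = (- 1)%R \/ ~ A x /\ sign_weight A x = 1%R.
  rewrite /sign_weight indicE; have [Ax|nAx] := pselect (A x); [left|right]; split => //.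
    by rewrite mem_set //=; ring.
  by rewrite memNset //= mulr0 subr0.
(* These instances exclude each of the four triples of image points, so at least two of the four
   weights are -1. *)
have := HA z; have := HA (- z)%R; have := HA (z.2, z.1); have := HA (- (z.2, z.1))%R.
rewrite /symmetrized_weight; case: z => x y /=.
rewrite (_ : ((- (y, x)).2, (- (y, x)).1) = (- (x, y)))%R//.
rewrite (_ : (- y, - x) = (- (y, x)))%R// !opprK.
case: (swE (p - (x, y))%R) => -[? ->]; case: (swE (p + (x, y))%R) => -[? ->];
case: (swE (p - (y, x))%R) => -[? ->]; case: (swE (p + (y, x))%R) => -[? ->];
  move=> *; solve [lra | exfalso; eauto].
Qed.

Lemma measurable_symmetrized_weight (A : set L2) (p : R * R) : measurable A ->
  measurable_fun [set: L2] (symmetrized_weight A p).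
Proof.
move=> mA; have autr := plane_automorphism_reflection p.
have auto := plane_automorphism_opp R.
have auts := plane_automorphism_swap R.
have m1 := measurable_sign_weight A _ autr mA.
have m3 := measurable_sign_weight A _ (plane_automorphism_comp _ _ _ auto autr) mA.
have m4 := measurable_sign_weight A _ (plane_automorphism_comp _ _ _ auts autr) mA.
have m5 := measurable_sign_weight A _ (plane_automorphism_comp _ _ _ auts
  (plane_automorphism_comp _ _ _ auto autr)) mA.
exact: (measurable_funD (measurable_funD
  (measurable_funD m1 m3) m4) m5).
Qed.

Lemma integral_symmetrized_weight (A : set L2) (p : R * R) (e : R) :
  measurable A -> (0 < e)%R ->
  4%:E * truncated_curvature K A p e =
  \int[mu]_(z in [set z | (e <= enorm z)%R])
    (symmetrized_weight A p z * punctured z)%:E.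
Proof.
move=> mA e0.
have autr := plane_automorphism_reflection p.
have auto := plane_automorphism_opp R.
have auts := plane_automorphism_swap R.
have autos := plane_automorphism_comp _ _ _ auts auto.
pose F (g : R * R -> R * R) (z : L2) : \bar R := (sign_weight A (p - g z) * punctured z)%:E.
have intF (g : R * R -> R * R) : plane_automorphism R g ->
    mu.-integrable [set z | (e <= enorm z)%R] (F g).
  move=> autg; apply: (integrable_sign_weight A (fun z => p - g z)%R) => //.
  exact: (plane_automorphism_comp _ _ _ autg autr).
have TF (g : R * R -> R * R) : plane_automorphism R g ->
    (forall z, enorm (g z) = enorm z) ->
    \int[mu]_(z in [set z | (e <= enorm z)%R]) F g z = truncated_curvature K A p e.
  by move=> autg isog; rewrite (truncated_curvature_isometry A p e g).
have autid : plane_automorphism R id.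
  have := plane_automorphism_comp _ _ _ auto auto.
  by congr plane_automorphism; apply/funext => z /=; rewrite opprK.
have mD := measurable_exterior e.
rewrite (eq_integral (fun z : L2 => F id z + F (fun z => - z)%R z
    + F (fun z => (z.2, z.1)) z + F (fun z => - (z.2, z.1))%R z)); last first.
  by move=> z _; rewrite /F -!EFinD -!mulrDl.
have i1 := intF _ autid; have i2 := intF _ auto.
have i3 := intF _ auts; have i4 := intF _ autos.
rewrite (integralD mD (integrableD mD (integrableD mD i1 i2) i3) i4).
rewrite (integralD mD (integrableD mD i1 i2) i3) (integralD mD i1 i2).
rewrite (TF id)// (TF _ auto (@enorm_opp R)) (TF _ auts (@enorm_swap R)).
rewrite (TF _ autos); last by move=> z /=; rewrite enorm_opp enorm_swap.
have Tfin : truncated_curvature K A p e \is a fin_num.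
  by rewrite -(TF id)//; exact: integrable_fin_num.
by rewrite -(fineK Tfin) -EFinM -!EFinD; congr EFin; ring.
Qed.

(** * Sign, monotonicity and convergence of truncated curvatures *)

Section nonpositive_symmetrized_weight.
Variables (A : set L2) (p : R * R).
Hypothesis mA : measurable A.
Hypothesis wA : forall z, (symmetrized_weight A p z <= 0)%R.

(** With a nonnegative integrand, positivity and monotonicity in the domain become available. *)
Lemma truncated_curvature_oppE (e : R) : (0 < e)%R ->
  4%:E * truncated_curvature K A p e =
  - \int[mu]_(z in [set z | (e <= enorm z)%R])
    (- (symmetrized_weight A p z * punctured z))%:E.
Proof.
move=> e0; rewrite integral_symmetrized_weight// -integral_ge0N.
  by apply: eq_integral => z _; rewrite -EFinN opprK.
by move=> z _; rewrite lee_fin oppr_ge0 mulr_le0_ge0// punctured_ge0.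
Qed.

Lemma truncated_curvature_le0 (e : R) : (0 < e)%R ->
  truncated_curvature K A p e <= 0.
Proof.
move=> e0; have : 4%:E * truncated_curvature K A p e <= 4%:E * 0.
  rewrite mule0 truncated_curvature_oppE// oppe_le0; apply: integral_ge0 => z _.
  by rewrite lee_fin oppr_ge0 mulr_le0_ge0// punctured_ge0.
by rewrite lee_pmul2l// lte_fin.
Qed.

Lemma truncated_curvature_nondecreasing (e1 e2 : R) : (0 < e1)%R -> (e1 <= e2)%R ->
  truncated_curvature K A p e1 <= truncated_curvature K A p e2.
Proof.
move=> e10 e12; have e20 := lt_le_trans e10 e12.
suff : 4%:E * truncated_curvature K A p e1 <= 4%:E * truncated_curvature K A p e2.
  by rewrite lee_pmul2l// lte_fin.
rewrite !truncated_curvature_oppE// leeN2.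
apply: ge0_subset_integral; [exact: measurable_exterior|exact: measurable_exterior| | |].
- apply/measurable_EFinP; apply: measurable_funTS.
  exact: (measurable_funN (measurable_funM
    (measurable_symmetrized_weight A p mA) measurable_punctured)).
- by move=> z _; rewrite lee_fin oppr_ge0 mulr_le0_ge0// punctured_ge0.
- by move=> z /=; exact: le_trans.
Qed.

Lemma cvg_truncated_curvature : cvg (truncated_curvature K A p e @[e --> 0^'+]).
Proof.
apply: nondecreasing_at_right_is_cvge; near=> x => e1 e2.
by rewrite !in_itv /= => /andP[e10 _] _; exact: truncated_curvature_nondecreasing.
Unshelve. all: by end_near. Qed.

End nonpositive_symmetrized_weight.

(** The weight of [A] is that of the difference minus twice the indicator of [B], and the difference
    has nonpositive truncated curvature. *)
Lemma truncated_curvature_setD_le (A B : set L2) (p : R * R) (e : R) :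
  measurable A -> measurable B -> B `<=` A -> (0 < e)%R ->
  (forall z, (symmetrized_weight (A `\` B) p z <= 0)%R) ->
  truncated_curvature K A p e <=
  - (2%:E * \int[mu]_(z in [set z | (e <= enorm z)%R] `&`
                      (fun z => p - z)%R @^-1` B) (punctured z)%:E).
Proof.
move=> mA mB BA e0 wAB; have mAB := measurableD mA mB.
have autr := plane_automorphism_reflection p.
have mD := measurable_exterior e.
have mB' := measurable_preimage _ B autr mB.
rewrite truncated_curvatureE//.
pose F (z : L2) : \bar R := (sign_weight (A `\` B) (p - z) * punctured z)%:E.
pose G (z : L2) : \bar R := (\1_((fun z => p - z)%R @^-1` B) z * punctured z)%:E.
have intF : mu.-integrable [set z | (e <= enorm z)%R] F.
  exact: (integrable_sign_weight (A `\` B) _ e autr mAB e0).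
have intG : mu.-integrable [set z | (e <= enorm z)%R] G.
  apply: (integrable_punctured e _ (\1_((fun z => p - z)%R @^-1` B)) e0 mD (@subset_refl _ _)).
    exact: measurable_indic.
  by move=> z; rewrite indicE; case: (_ \in _); rewrite /= ?normr1 ?normr0 ?ler01.
rewrite (eq_integral (fun z : L2 => F z + (- 2)%R%:E * G z)); last first.
  move=> z _; rewrite /F /G -EFinM -EFinD (mulrA (- 2)%R) -mulrDl /sign_weight !indicE.
  congr ((_ * _)%:E).
  have -> : (z \in (fun z => p - z)%R @^-1` B) = ((p - z)%R \in B) by [].
  rewrite in_setD; have [pB|pB] := boolP ((p - z)%R \in B).
    by rewrite mem_set; [rewrite /=; ring|apply: BA; rewrite -inE].
  by rewrite andbT /=; ring.
rewrite (integralD mD intF (integrableZl mD _ intG)) (integralZl mD intG).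
have -> : \int[mu]_(z in [set z | (e <= enorm z)%R] `&`
    (fun z => p - z)%R @^-1` B) (punctured z)%:E =
    \int[mu]_(z in [set z | (e <= enorm z)%R]) G z.
  rewrite integral_mkcondr; apply: eq_integral => z _; rewrite /G patchE indicE.
  by case: (_ \in _); rewrite ?mul1r ?mul0r.
rewrite EFinN mulNe -[leRHS]add0e; apply: leeD => //.
by rewrite /F -truncated_curvatureE// truncated_curvature_le0.
Qed.

(* Rotating by the angle of [p - c] brings the ball [B_(r/4)(c)], seen from
   [p], to the ball of [Psi]. *)
Lemma integral_punctured_ball (r a b e : R) (p : R * R) : (0 < e)%R -> (e <= r)%R ->
  (b != 0)%R -> (a ^+ 2 + b ^+ 2 = 1)%R ->
  \int[mu]_(z in [set z | (e <= enorm z)%R] `&` (fun z => p - z)%R @^-1`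
     eball (p - (7 * r / 4 * a, 7 * r / 4 * b))%R (r / 4)%R) (punctured z)%:E = Psi K r.
Proof.
move=> e0 er b0 ab1; have r0 := lt_le_trans e0 er.
pose rot z : R * R := (a * z.1 + b * z.2, a * z.2 - b * z.1)%R.
have autrot : plane_automorphism R rot by exact: plane_automorphism_rotation.
have isorot z : enorm (rot z) = enorm z by exact: enorm_rotation.
pose B : set L2 := eball (7 * r / 4, 0)%R (r / 4)%R.
have mB : measurable B by exact: measurable_eball.
(* Points of this ball have first coordinate above [7 * r / 4 - r / 4], which exceeds [r] and hence
   [e]. *)
have Be : B `<=` [set z | (e <= enorm z)%R].
  move=> z /= Bz; apply: le_trans (norm1_le_enorm R z).
  have := le_lt_trans (norm1_le_enorm R _) Bz; rewrite ltr_norml /= => /andP[z1 _].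
  by apply: le_trans (ler_norm _); lra.
have mD := measurable_exterior e.
rewrite (_ : _ `&` _ = rot @^-1` B); last first.
  have BE z : (rot @^-1` B) z <->
      eball (p - (7 * r / 4 * a, 7 * r / 4 * b))%R (r / 4)%R (p - z)%R.
    rewrite /B /eball /=; set w := (7 * r / 4 * a, 7 * r / 4 * b)%R.
    have -> : (p - z - (p - w) = - (z - w))%R.
      by rewrite (opprB p) [LHS]addrC addrA subrK opprB.
    rewrite enorm_opp -(isorot (z - w)%R).
    (* [rot] is linear and takes [w] to [(7 * r / 4, 0)]. *)
    have -> : (rot z - (7 * r / 4, 0) = rot (z - w))%R; last by [].
    rewrite /rot /w /=; congr pair => /=; last ring.
    rewrite -[in LHS](mulr1 (7 * r / 4)%R) -ab1; ring.
  apply/seteqP; split => z; first by case=> _ Bz; exact: ((BE z).2 Bz).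
  move=> Bz; split; last exact: ((BE z).1 Bz).
  by have /= := Be _ Bz; rewrite isorot.
have mk : measurable_fun [set: L2] (fun z => (punctured z)%:E).
  by apply/measurable_EFinP; exact: measurable_punctured.
have intk : mu.-integrable B (fun z => (punctured z)%:E).
  have := integrable_punctured e B (cst 1%R) e0 mB Be (measurable_cst _).
  by under eq_fun do rewrite mul1r; apply => z; rewrite normr1.
transitivity (\int[mu]_(z in rot @^-1` B) (punctured (rot z))%:E).
  by apply: eq_integral => z _; rewrite (eq_punctured (rot z) z).
etransitivity; first exact: (integral_plane_automorphism _ rot B _ autrot mB mk intk).
apply: eq_integral => z; rewrite inE => Bz; rewrite puncturedE//.
exact: lt_le_trans e0 (Be z Bz).
Qed.

End symmetrization.

(** * Measurability of the set and position of the removed ball *)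

Lemma measurable_cone_square (R : realType) (r : R) :
  measurable (cone_square r : set (measurableTypeR R * measurableTypeR R)).
Proof.
pose RR : measurableType _ := (measurableTypeR R * measurableTypeR R)%type.
have n1 : measurable_fun [set: RR] (fun x : RR => `|x.1| : R)%R.
  apply: (@measurableT_comp _ _ _ RR R R (fun y => `|y|)%R _ (fun x => x.1)).
    exact: normr_measurable.
  exact: measurable_fst.
have n2 : measurable_fun [set: RR] (fun x : RR => `|x.2| : R)%R.
  apply: (@measurableT_comp _ _ _ RR R R (fun y => `|y|)%R _ (fun x => x.2)).
    exact: normr_measurable.
  exact: measurable_snd.
rewrite (_ : cone_square r =
  [set x | `|x.2| <= r]%R `|` [set x | `|x.2| <= `|x.1|]%R); last first.
  by apply/seteqP; split => x /cone_squareE.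
apply: measurableU.
- have := measurable_fun_ler n2 (measurable_cst (r : R)).
  by move=> /(_ measurableT [set true]); rewrite setTI; exact.
- have := measurable_fun_ler n2 n1.
  by move=> /(_ measurableT [set true]); rewrite setTI; exact.
Qed.

(** The centre lies on the vertical axis at distance [7 * r / 4] from [(t, r)], at a height between
    [- 0.75 * r] and [- 0.43 * r]. The ball therefore stays above [- r], and also below both
    diagonals, since [0.43 / sqrt 2 > 1 / 4]. *)
Lemma ball_in_cone_square (R : realType) (r t c : R) (y : R * R) : (0 < r)%R ->
  (- r <= t <= r)%R -> (0 < c)%R -> (t ^+ 2 + c ^+ 2 = (7 * r / 4) ^+ 2)%R ->
  eball (0, r - c)%R (r / 4)%R y ->
  [/\ (`|y.2| <= r)%R, (y.2 < 0)%R & (`|y.1| < `|y.2|)%R].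
Proof.
case: y => x y r0 /andP[t1 t2] c0 tc; rewrite /eball /= enorm_ltE ?divr_gt0//=.
rewrite subr0 => B.
have sqr_lt (u v : R) : (0 <= v -> u ^+ 2 < v ^+ 2 -> u < v)%R.
  move=> v0 uv; rewrite ltNge; apply/negP => vu.
  have : (0 <= (u - v) * (u + v))%R by apply: mulr_ge0; lra.
  lra.
have t2r : (0 <= (r - t) * (r + t))%R by apply: mulr_ge0; lra.
have r2 : (0 < r ^+ 2)%R by rewrite exprn_gt0.
have x2 := sqr_ge0 x; have y2 := sqr_ge0 (y - (r - c))%R; have tt := sqr_ge0 t.
have c1 : (c <= 7 * r / 4)%R.
  rewrite leNgt; apply/negP => rc.
  have : (0 < (c - 7 * r / 4) * (c + 7 * r / 4))%R by apply: mulr_gt0; lra.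
  lra.
(* [c ^ 2 >= (49 / 16 - 1) r ^ 2] and [sqrt (33 / 16) > 1.43] *)
have c2 : (143 / 100 * r < c)%R by apply: sqr_lt; lra.
have y1 : (y - (r - c) < r / 4)%R by apply: sqr_lt; lra.
have y3 : (- (y - (r - c)) < r / 4)%R by apply: sqr_lt; lra.
(* In a disc of radius [r / 4] the sum of the coordinates relative to the centre is below
   [sqrt 2 * r / 4 < 0.36 * r], and [0.36 < 0.43]. *)
have x1 : (x + (y - (r - c)) < 36 / 100 * r)%R.
  by apply: sqr_lt; have := sqr_ge0 (x - (y - (r - c)))%R; lra.
have x3 : (- x + (y - (r - c)) < 36 / 100 * r)%R.
  by apply: sqr_lt; have := sqr_ge0 (x + (y - (r - c)))%R; lra.
have y0 : (y < 0)%R by lra.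
split => //.
  by rewrite ler_norml; apply/andP; split; lra.
by rewrite (ltr0_norm y0) ltr_norml; apply/andP; split; lra.
Qed.

(** * The curvature inequalities *)

Theorem proposition1p4 (R : realType) (K0 : R -> R) (K : R * R -> R)
    (K0_ge0 : forall s : R, (0 < s)%R -> (0 <= K0 s)%R)
    (K_radial : forall x : R * R, x <> 0%R -> K x = K0 (enorm x))
    (K_int : (@leb2 R).-integrable setT
               (fun x : R * R => (Num.min 1 (enorm x) * K x)%R%:E))
    (r : R) (r_gt0 : (0 < r)%R) :
  (forall p : R * R, frontier (cone_square r) p ->
     cvg (truncated_curvature K (cone_square r) p e @[e --> 0^'+]) /\
     curvature K (cone_square r) p <= 0) /\
  (forall t : R, (- r <= t <= r)%R ->
     curvature K (cone_square r) (t, r) <= - (2%:E * Psi K r)).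
Proof.
have mE := measurable_leb2 R _ (measurable_cone_square R r).
split=> [p pE|t tr].
  have w0 := symmetrized_weight_le0 R (cone_square r) p
    (fun z => frontier_reflections R r r_gt0 p z (frontier_cone_square R r p pE)).
  have cvgT := cvg_truncated_curvature R K0 K K0_ge0 K_radial K_int _ p mE w0.
  split=> //; apply: lime_le => //; near=> e.
  by apply: (truncated_curvature_le0 R K0 K K0_ge0 K_radial K_int _ p mE w0).
have tE : (`|(t, r).1| <= r /\ `|(t, r).2| = r \/ `|(t, r).2| = `|(t, r).1|)%R.
  by left; split; [rewrite ler_norml|rewrite gtr0_norm].
have w0 := symmetrized_weight_le0 R (cone_square r) (t, r)
  (fun z => frontier_reflections R r r_gt0 (t, r) z tE).
have cvgT := cvg_truncated_curvature R K0 K K0_ge0 K_radial K_int _ (t, r) mE w0.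
pose L := (7 * r / 4)%R.
(* The depth that puts [(0, r - c)] at distance [L] from [(t, r)]; it is positive since
   [|t| <= r < L]. *)
pose c := Num.sqrt (L ^+ 2 - t ^+ 2)%R.
have tL : (0 < L ^+ 2 - t ^+ 2)%R.
  have : (0 <= (r - t) * (r + t))%R by case/andP: tr => *; apply: mulr_ge0; lra.
  have : (0 < r ^+ 2)%R by rewrite exprn_gt0.
  rewrite /L; lra.
have tc : (t ^+ 2 + c ^+ 2 = L ^+ 2)%R by rewrite sqr_sqrtr ?ltW// subrKC.
have c0 : (0 < c)%R by rewrite sqrtr_gt0.
have L0 : (0 < L)%R by rewrite /L; lra.
(* The unit vector [(t / L, c / L)] supplies the cosine and sine of the rotation taking this ball to
   that of [Psi]. *)
have centerE : ((t, r) - (L * (t / L), L * (c / L)) = (0, r - c))%R.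
  by congr pair; rewrite /= mulrC divfK ?gt_eqF// subrr.
have bE := ball_in_cone_square R r t c _ r_gt0 tr c0 tc.
have mB := measurable_eball R (0, r - c)%R (r / 4)%R.
have BE : eball (0, r - c)%R (r / 4)%R `<=` cone_square r.
  by move=> y /bE[yr _ _]; apply/cone_squareE; left.
have out y : ~ (cone_square r `\` eball (0, r - c)%R (r / 4)%R) y -> above_or_below R r y.
  move=> yEB; have [By|nBy] := pselect (eball (0, r - c)%R (r / 4)%R y).
    by have [_ y0 yy] := bE y By; split => //; right.
  have : ~ cone_square r y by move=> Ey; apply: yEB.
  move=> /cone_squareE/not_orP[/negP + /negP]; rewrite -!ltNge => ry yy; split => //.
  by move: ry; rewrite ltr_normr => /orP[|ry];
    [left|right; rewrite -oppr_gt0; exact: lt_trans ry].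
have wB := symmetrized_weight_le0 R (cone_square r `\` eball (0, r - c)%R (r / 4)%R) (t, r)
  (fun z h1 h2 h3 => top_edge_reflections R r t z tr (out _ h1) (out _ h2) (out _ h3)).
(* The bound does not depend on [e] once [e <= r], so it passes to the limit. *)
apply: lime_le => //; near=> e.
have e0 : (0 < e)%R by [].
have er : (e <= r)%R by near: e; exact: nbhs_right_le.
have := truncated_curvature_setD_le R K0 K K0_ge0 K_radial K_int _ _ _ e mE mB BE e0 wB.
rewrite -centerE (integral_punctured_ball R K0 K K0_ge0 K_radial K_int)//.
  by rewrite mulf_neq0 ?invr_eq0 ?gt_eqF.
by rewrite (expr_div_n t) (expr_div_n c) -mulrDl tc divff// expf_neq0// gt_eqF.
Unshelve. all: by end_near. Qed.
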